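(* Let $\Lambda\colon\mathbb{R}\to[0,1]$ be in standard representation. The following are equivalent: (a) $\Lambda$ is right lower semicontinuous, i.e. $\liminf_{y\downarrow x}\Lambda(y)\ge\Lambda(x)$ for all $x\in\mathbb{R}$. (b) For all $F\in\mathcal M$ with $Q_\Lambda^-(F)\in\mathbb{R}$, it holds that $F\big(Q_\Lambda^-(F)\big)\ge\Lambda\big(Q_\Lambda^-(F)\big)$.
   Context: $\mathcal M$ is the set of cumulative distribution functions on $\mathbb{R}$. For $\Lambda\colon\mathbb{R}\to[0,1]$ and $F\in\mathcal M$, $Q_\Lambda^-(F):=\inf\{x\in\mathbb{R}\mid F(x)\ge\Lambda(x)\}\in[-\infty,\infty]$, with $\inf\varnothing=\infty$. Let $N_0:=\inf\{x\in\mathbb{R}\mid\Lambda(x)=0\}$; $\Lambda$ is in standard representation if $\Lambda(x)=0$ for all real $x>N_0$. *)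

(* Defs.v *)
From HB Require Import structures.
From mathcomp Require Import all_boot all_order all_algebra.
From mathcomp Require Import all_classical all_reals all_analysis.
Set Implicit Arguments.
Unset Strict Implicit.
Unset Printing Implicit Defensive.
Import Order.TTheory GRing.Theory Num.Theory.
Import numFieldNormedType.Exports.
Local Open Scope classical_set_scope.
Local Open Scope ring_scope.

(* Infima are taken in \bar R, where [ereal_inf set0 = +oo]. *)
Definition lambda_quantile (R : realType) (Lam F : R -> R) : \bar R :=
  ereal_inf [set x%:E | x in [set x : R | F x >= Lam x]].

Definition first_zero (R : realType) (Lam : R -> R) : \bar R :=
  ereal_inf [set x%:E | x in [set x : R | Lam x = 0]].

Definition standard_representation (R : realType) (Lam : R -> R) : Prop :=
  forall x : R, (first_zero Lam < x%:E)%E -> Lam x = 0.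

(* [x^'+] is the filter of right neighbourhoods of [x], with [x] excluded. *)
Definition right_lower_semicontinuous (R : realType) (Lam : R -> R) : Prop :=
  forall x : R, (limf_einf (fun y : R => (Lam y)%:E) x^'+ >= (Lam x)%:E)%E.

(* Main.v *)
Require Import Defs.
From HB Require Import structures.
From mathcomp Require Import all_boot all_order all_algebra.
From mathcomp Require Import all_classical all_reals all_analysis.
Import Order.TTheory GRing.Theory Num.Theory.
Import numFieldNormedType.Exports.
Local Open Scope classical_set_scope.
Local Open Scope ring_scope.

(* If F(q) < Lam(q) at q = Q(F), then right-continuity of F and right lower
   semicontinuity of Lam give F < Lam on some interval [q, q + d[, so the
   infimum defining Q(F) would exceed q.  Conversely, if Lam(y) <= c < Lam(x)
   for points y arbitrarily close to x on the right, the cdf with jump c at x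
   and jump 1 - c at x + 1 has Q(F) = x: standard representation forces Lam > 0
   to the left of x, where F = 0.  But F(x) = c < Lam(x). *)

(** The lower limit is the supremum, over right neighbourhoods [V] of [x], of the infimum of [Lam]
    on [V]: a [c] below it lies below one of these infima. Conversely, [c := Lam x - e] makes
    [[set y | Lam x - e < Lam y]] such a [V]. *)
Lemma right_lower_semicontinuousP (R : realType) (Lam : R -> R) :
  right_lower_semicontinuous Lam <->
  (forall x c : R, c < Lam x -> \forall y \near x^'+, c < Lam y).
Proof.
split=> [rlsc x c cx|near_gt x]; last first.
  apply/lee_subgt0Pr => e e0; rewrite limf_einfE -EFinB.
  apply: le_ereal_sup_tmp; exists (ereal_inf
    [set (Lam y)%:E | y in [set y | Lam x - e < Lam y]]).
    exists [set y | Lam x - e < Lam y] => //.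
    by apply: near_gt; rewrite gtrBl.
  by apply/ereal_infP => _ [y /= exy <-]; rewrite lee_fin ltW.
have := rlsc x; rewrite limf_einfE => Lx.
have : (c%:E < (Lam x)%:E)%E by rewrite lte_fin.
move=> /lt_le_trans /(_ Lx) /ereal_sup_gtP[_ [V Vx <-] cV].
apply: filterS Vx => y Vy; rewrite -lte_fin (lt_le_trans cV)//.
by apply: ereal_inf_lbound; exists y.
Qed.

Definition two_step (R : realType) (a b c t : R) : R :=
  if t < a then 0 else if t < b then c else 1.

Lemma two_step_cdf (R : realType) (a b c : R) : 0 <= c <= 1 ->
  exists F : cumulativeBounded (0 : R) (1 : R), F =1 two_step R a b c.
Proof.
move=> /andP[c0 c1].
have F_nd : nondecreasing (two_step R a b c).
  move=> s t st; rewrite /two_step.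
  have [ta|xt] := ltP t a; first by rewrite (le_lt_trans st ta).
  have [tb|bt] := ltP t b.
    by rewrite (le_lt_trans st tb); case: ifP.
  by case: ifP => // _; case: ifP.
have F_rc : right_continuous (two_step R a b c).
  (* Strict tests keep their truth value just to the right of [t], so [two_step] is constant
     there. *)
  have near_lt (u t : R) : \forall s \near t^'+, (s < u) = (t < u).
    have [tu|ut] := ltP t u; first exact: nbhs_right_lt.
    apply: filterS (nbhs_right_ge t) => s ts.
    by apply/negbTE; rewrite -leNgt (le_trans ut ts).
  move=> t; apply: cvg_near_cst; near=> s.
  have sa : (s < a) = (t < a) by near: s; exact: near_lt.
  have sb : (s < b) = (t < b) by near: s; exact: near_lt.
  by rewrite /two_step sa sb.
have F_Ny : two_step R a b c @ -oo --> (0 : R).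
  apply: cvg_near_cst; near=> s; rewrite /two_step.
  by have -> : s < a by near: s; apply: nbhs_ninfty_lt; exact: num_real.
have F_y : two_step R a b c @ +oo --> (1 : R).
  apply: cvg_near_cst; near=> s; rewrite /two_step.
  have sa : a <= s by near: s; apply: nbhs_pinfty_ge; exact: num_real.
  have sb : b <= s by near: s; apply: nbhs_pinfty_ge; exact: num_real.
  by rewrite !ltNge sa sb.
pose Fc := isCumulative.Build R _ R (two_step R a b c) F_nd F_rc.
pose Fb := isCumulativeBounded.Build R 0 1 (two_step R a b c) F_Ny F_y.
pose F : cumulativeBounded (0 : R) (1 : R) := HB.pack (two_step R a b c) Fc Fb.
by exists F.
Unshelve. all: by end_near. Qed.

Theorem lemma2p5 (R : realType) (Lam : R -> R)
    (Lam01 : forall x : R, 0 <= Lam x <= 1)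
    (Lamstd : standard_representation Lam) :
  right_lower_semicontinuous Lam <->
  (forall F : cumulativeBounded (0 : R) (1 : R),
     lambda_quantile Lam F \is a fin_num ->
     F (fine (lambda_quantile Lam F)) >= Lam (fine (lambda_quantile Lam F))).
Proof.
rewrite right_lower_semicontinuousP; split=> [near_gt F|FQ x c cx].
  move=> /fineK; set q := fine _ => Qq.
  rewrite leNgt; apply/negP => Fq.
  (* A level [c] strictly in between lets the two one-sided conditions be used separately: [F] stays
     below [c] and [Lam] above it. *)
  have [c /andP[Fc cL]] : exists c, F q < c < Lam q.
    by exists ((F q + Lam q) / 2); rewrite !midf_lt.
  have F_near : \forall y \near q^'+, F y < c.
    exact: (cvgr_lt _ (cumulative_is_right_continuous F q)).
  have : \forall y \near q^'+, F y < Lam y.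
    by near=> y; apply: (@lt_trans _ _ c); near: y; [|exact: near_gt].
  move=> [d /= d0 qd].
  suff : ((q + d)%:E <= lambda_quantile Lam F)%E.
    by rewrite -Qq lee_fin gerDl leNgt d0.
  apply/ereal_infP => _ [y /= yF <-]; rewrite lee_fin leNgt; apply/negP => yd.
  have qy : q <= y.
    by rewrite -lee_fin Qq; apply: ereal_inf_lbound; exists y.
  (* The filter [q^'+] excludes [q], so [y = q] is refuted by [Fq] instead. *)
  move: qy; rewrite le_eqVlt => /orP[/eqP qy|qy].
    by move: yF; rewrite -qy leNgt Fq.
  move: (qd y) => /=; rewrite (ltNge (F y)) yF => H.
  by apply: notF; apply: H => //; rewrite distrC gtr0_norm ?subr_gt0// ltrBlDl.
apply: contrapT => not_near.
have often d : 0 < d -> exists y, [/\ x < y, y < x + d & Lam y <= c].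
  move=> d0; apply: contrapT => no_y; apply: not_near.
  near=> y; rewrite ltNge; apply/negP => yc; apply: no_y; exists y.
  split; last exact: yc.
  - by near: y; exact: nbhs_right_gt.
  - by near: y; apply: nbhs_right_lt; rewrite ltrDl.
(* Some [y] has [0 <= Lam y <= c]; the window width 1 is arbitrary. *)
have c0 : 0 <= c.
  have [y [_ _]] := often 1 ltr01; apply: le_trans.
  by have /andP[] := Lam01 y.
have c1 : c <= 1 by rewrite (le_trans (ltW cx))//; have /andP[] := Lam01 x.
have [F FE] : exists F : cumulativeBounded (0 : R) (1 : R),
    F =1 two_step R x (x + 1) c by apply: two_step_cdf; rewrite c0.
have Fx : F x = c by rewrite FE /two_step ltxx ltrDl ltr01.
have Lam_gt0 t : t < x -> 0 < Lam t.
  move=> tx; rewrite lt_neqAle eq_sym; have /andP[-> _] := Lam01 t.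
  rewrite andbT; apply/eqP => Lt0.
  (* A zero at [t < x] puts [first_zero Lam] strictly below [x]. *)
  have Lx0 : Lam x = 0.
    apply: Lamstd; apply: (@le_lt_trans _ _ t%:E); last by rewrite lte_fin.
    by apply: ereal_inf_lbound; exists t.
  by move: cx; rewrite Lx0 ltNge c0.
have Qx : lambda_quantile Lam F = x%:E.
  apply/eqP; rewrite eq_le; apply/andP; split.
    apply/lee_addgt0Pr => e e0.
    (* The bound [e] keeps [y] close to [x]; the bound 1 keeps it before the second jump, so that
       [F y = c >= Lam y]. *)
    have [|y [xy yd yc]] := often (Num.min e 1); first by rewrite lt_min e0 ltr01.
    move: yd; rewrite -ltrBlDl lt_min !ltrBlDl => /andP[ye y1].
    apply: (@le_trans _ _ y%:E); last by rewrite -EFinD lee_fin ltW.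
    apply: ereal_inf_lbound; exists y => //=.
    by rewrite FE /two_step ltNge (ltW xy) y1.
  apply/ereal_infP => _ [t /= tF <-]; rewrite lee_fin leNgt; apply/negP => tx.
  by move: tF; rewrite FE /two_step tx leNgt Lam_gt0.
have := FQ F; rewrite Qx => /(_ isT) /=.
by rewrite Fx leNgt cx.
Unshelve. all: by end_near. Qed.
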